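(* Let $\mathcal L$ and $\mathcal L_n$ ($n\ge 0$) be real separable Hilbert spaces and let $\Phi_n:\mathcal L\to\mathcal L_n$ be linear operators with $\lim_{n\to\infty}\|\Phi_n u\|_{\mathcal L_n}=\|u\|_{\mathcal L}$ for all $u\in\mathcal L$. Let $(\mathcal E,\mathcal H)$ be a bilinear closed form on $\mathcal L$ and, for each $n$, let $(\mathcal E^n,\mathcal H_n)$ be a bilinear closed form on $\mathcal L_n$, all satisfying $(\mathcal E.1)$ and $(\mathcal E.2)$ with one common constant $\alpha_0\in\mathbb R$ (the sector constants may depend on $n$). Let $(G_\alpha)_{\alpha>\alpha_0},(T_t)_{t\ge0}$ and $(G^n_\alpha)_{\alpha>\alpha_0},(T^n_t)_{t\ge0}$ be the associated resolvents and semigroups. Denote $\|\Phi_n\|=\sup_{f\in\mathcal L:\|f\|_{\mathcal L}=1}\|\Phi_nf\|_{\mathcal L_n}$ and assume $\sup_{n\ge0}\|\Phi_n\|<\infty$. Then the following statements are equivalent: (1) for some $\alpha>\alpha_0$, $G^n_\alpha$ strongly converges to $G_\alpha$; (2) $T^n_t$ strongly converges to $T_t$ for all $t\ge0$; (3) $T^n_t$ strongly converges to $T_t$ uniformly on bounded intervals, i.e. for all $T>0$ and all sequences $(f_n)$, $f_n\in\mathcal L_n$, strongly converging to some $f\in\mathcal L$, $$\lim_{n\to\infty}\sup_{t\in[0,T]}\|T^n_tf_n-\Phi_nT_tf\|_{\mathcal L_n}=0.$$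
   Context: **Closed forms.** Let $\mathcal L$ be a real separable Hilbert space and $\mathcal E$ a bilinear form with domain $\mathcal H$, a dense linear subspace of $\mathcal L$. Let $\mathcal E^s(u,v)=\frac12(\mathcal E(u,v)+\mathcal E(v,u))$ and, for $\alpha\in\mathbb R$, $\mathcal E_\alpha=\mathcal E+\alpha\langle\cdot,\cdot\rangle_{\mathcal L}$, $\mathcal E^s_\alpha=\mathcal E^s+\alpha\langle\cdot,\cdot\rangle_{\mathcal L}$. The form is a *bilinear closed form* with constant $\alpha_0\in\mathbb R$ if - $(\mathcal E.1)$ $\mathcal E^s_{\alpha_0}$ is positive definite, in the sense $\mathcal E^s_{\alpha_0}(u,u)\ge0$ for $u\in\mathcal H$, and $\mathcal H$ with the inner product $\mathcal E^s_{\alpha_0+1}$ is a Hilbert space; - $(\mathcal E.2)$ there is $K\ge1$ with $|\mathcal E_{\alpha_0+1}(u,v)|\le K\,\mathcal E_{\alpha_0+1}(u,u)^{1/2}\mathcal E_{\alpha_0+1}(v,v)^{1/2}$ for all $u,v\in\mathcal H$. The associated resolvent $(G_\alpha)_{\alpha>\alpha_0}$ is the unique strongly continuous contraction resolvent on $\mathcal L$ (resolvent equation, $\|(\alpha-\alpha_0)G_\alpha\|\le 1$, $\alpha G_\alpha f\to f$ as $\alpha\to\infty$) with $G_\alpha(\mathcal L)\subset\mathcal H$ and $\mathcal E_\alpha(G_\alpha f,u)=\langle f,u\rangle_{\mathcal L}$ for all $f\in\mathcal L$, $u\in\mathcal H$. The associated semigroup $(T_t)_{t\ge0}$ is the unique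 strongly continuous semigroup on $\mathcal L$ with $\|e^{-\alpha_0t}T_t\|\le1$ for $t>0$ and $G_\alpha f=\int_0^\infty e^{-\alpha t}T_tf\,dt$ (Bochner integral) for $\alpha>\alpha_0$. **Convergence along $\mathcal L_n\to\mathcal L$.** For $u_n\in\mathcal L_n$, $u\in\mathcal L$: $(u_n)$ *strongly converges* to $u$ if $\|\Phi_nu-u_n\|_{\mathcal L_n}\to0$. Bounded operators $A_n$ on $\mathcal L_n$ *strongly converge* to a bounded operator $A$ on $\mathcal L$ if $A_nu_n$ strongly converges to $Au$ whenever $u_n\in\mathcal L_n$ strongly converges to $u\in\mathcal L$. *)

(* Defs.v *)
From HB Require Import structures.
From mathcomp Require Export all_boot all_order all_algebra.
From mathcomp Require Export all_classical all_reals all_analysis.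
Export Order.TTheory GRing.Theory Num.Theory.
Export numFieldNormedType.Exports.

Set Implicit Arguments.
Unset Strict Implicit.
Unset Printing Implicit Defensive.

Local Open Scope classical_set_scope.
Local Open Scope ring_scope.

HB.mixin Record isHilbert (R : realType) V of CompleteNormedModule R V := {
  inner : V -> V -> R;
  inner_sym : forall u v, inner u v = inner v u;
  inner_linear : forall a u v w,
    inner (a *: u + v) w = a * inner u w + inner v w;
  inner_norm : forall u, inner u u = `|u| ^+ 2
}.

#[short(type="hilbertType")]
HB.structure Definition Hilbert (R : realType) :=
  { V of isHilbert R V & CompleteNormedModule R V }.

Definition separable (T : topologicalType) : Prop :=
  exists2 D : set T, countable D & dense D.

(* The supremum is taken in [\bar R], where the empty one is -oo; an upper
   bound on it thus remains meaningful when [V] is the null space. *)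
Definition opnorm (R : realType) (V W : normedModType R) (A : V -> W) : \bar R :=
  ereal_sup [set (`|A f|)%:E | f in [set f : V | `|f| = 1]].

(* A form with domain [H] is given by a total function [L -> L -> R] of which
   only the values on [H] matter. *)

Definition linear_subspace (R : realType) (L : lmodType R) (H : set L) : Prop :=
  H 0 /\ forall (a : R) u v, H u -> H v -> H (a *: u + v).

Definition bilinear_on (R : realType) (L : lmodType R) (H : set L)
    (E : L -> L -> R) : Prop :=
  forall (a : R) u v w, H u -> H v -> H w ->
    E (a *: u + v) w = a * E u w + E v w /\
    E w (a *: u + v) = a * E w u + E w v.

Definition sym_part (R : realType) (L : lmodType R) (E : L -> L -> R)
  (u v : L) : R := (E u v + E v u) / 2.

Definition form_shift (R : realType) (L : hilbertType R) (a : R)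
  (E : L -> L -> R) (u v : L) : R := E u v + a * inner u v.

Record hilbert_on (R : realType) (L : lmodType R) (H : set L)
    (B : L -> L -> R) : Prop := {
  hilbert_on_subspace : linear_subspace H;
  hilbert_on_bilinear : bilinear_on H B;
  hilbert_on_sym : forall u v, H u -> H v -> B u v = B v u;
  hilbert_on_pos : forall u, H u -> u != 0 -> 0 < B u u;
  hilbert_on_complete : forall u : nat -> L, (forall n, H (u n)) ->
    (forall e : R, 0 < e -> exists N, forall m n, (N <= m)%N -> (N <= n)%N ->
       Num.sqrt (B (u m - u n) (u m - u n)) < e) ->
    exists2 v, H v & Num.sqrt (B (u n - v) (u n - v)) @[n --> \oo] --> (0 : R)
}.

Record bilinear_closed_form (R : realType) (L : hilbertType R) (alpha0 : R)
    (H : set L) (E : L -> L -> R) : Prop := {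
  form_subspace : linear_subspace H;
  form_dense : dense H;
  form_bilinear : bilinear_on H E;
  form_nonneg : forall u, H u -> 0 <= form_shift alpha0 (sym_part E) u u;
  form_hilbert : hilbert_on H (form_shift (alpha0 + 1) (sym_part E));
  form_sector : exists2 K : R, 1 <= K & forall u v, H u -> H v ->
    `|form_shift (alpha0 + 1) E u v| <=
      K * Num.sqrt (form_shift (alpha0 + 1) E u u)
        * Num.sqrt (form_shift (alpha0 + 1) E v v)
}.

(* The resolvent is indexed by all of [R], but only its values at
   [alpha > alpha0] matter; similarly for the semigroup and [t >= 0]. *)

Record associated_resolvent (R : realType) (L : hilbertType R) (alpha0 : R)
    (H : set L) (E : L -> L -> R) (G : R -> {linear L -> L}) : Prop := {
  resolvent_eq : forall a b, alpha0 < a -> alpha0 < b ->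
    forall f, G a f - G b f = (b - a) *: G a (G b f);
  resolvent_contraction : forall a, alpha0 < a ->
    (opnorm (fun f => ((a - alpha0) *: G a f)%R) <= 1)%E;
  resolvent_continuous : forall f, a *: G a f @[a --> +oo] --> f;
  resolvent_range : forall a, alpha0 < a -> forall f, H (G a f);
  resolvent_form : forall a, alpha0 < a ->
    forall f u, H u -> form_shift a E (G a f) u = inner f u
}.

(* [g] is the simple function \sum_i 1_(A_i) c_i, supported in [D], and [J] is
   its integral. *)
Definition simple_integral d (T : measurableType d) (R : realType)
    (mu : {measure set T -> \bar R}) (V : normedModType R)
    (D : set T) (g : T -> V) (J : V) : Prop :=
  exists (m : nat) (A : 'I_m -> set T) (c : 'I_m -> V),
    [/\ forall i, [/\ measurable (A i), A i `<=` D & (mu (A i) < +oo)%E],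
        forall x, g x = \sum_(i < m) (\1_(A i) x : R) *: c i &
        J = \sum_(i < m) fine (mu (A i)) *: c i].

(* [f] is Bochner integrable over [D], with integral [I]. The a.e. convergence
   is the strong measurability of [f]. *)
Definition bochner_integral d (T : measurableType d) (R : realType)
    (mu : {measure set T -> \bar R}) (V : normedModType R)
    (D : set T) (f : T -> V) (I : V) : Prop :=
  exists (s : nat -> T -> V) (J : nat -> V),
    [/\ forall k, simple_integral mu D (s k) (J k),
        {ae mu, forall x, D x -> s k x @[k --> \oo] --> f x},
        (\int[mu]_(x in D) (`|f x - s k x|)%:E)%E @[k --> \oo] --> 0%E &
        J k @[k --> \oo] --> I].

Record associated_semigroup (R : realType) (L : hilbertType R) (alpha0 : R)
    (G : R -> {linear L -> L}) (T : R -> {linear L -> L}) : Prop := {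
  semigroup0 : forall f, T 0 f = f;
  semigroupD : forall s t, 0 <= s -> 0 <= t ->
    forall f, T (s + t) f = T s (T t f);
  semigroup_continuous : forall f, T t f @[t --> 0^'+] --> f;
  semigroup_contraction : forall t, 0 < t ->
    (opnorm (fun f => (expR (- (alpha0 * t)) *: T t f)%R) <= 1)%E;
  semigroup_resolvent : forall a, alpha0 < a -> forall f,
    bochner_integral (@lebesgue_measure R) `[0, +oo[
      (fun t => expR (- (a * t)) *: T t f) (G a f)
}.

Definition strong_cvg (R : realType) (L : hilbertType R)
    (Ln : nat -> hilbertType R) (Phi : forall n, {linear L -> Ln n})
    (un : forall n, Ln n) (u : L) : Prop :=
  `|Phi n u - un n| @[n --> \oo] --> (0 : R).

Definition op_strong_cvg (R : realType) (L : hilbertType R)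
    (Ln : nat -> hilbertType R) (Phi : forall n, {linear L -> Ln n})
    (An : forall n, Ln n -> Ln n) (A : L -> L) : Prop :=
  forall (un : forall n, Ln n) (u : L),
    strong_cvg Phi un u -> strong_cvg Phi (fun n => An n (un n)) (A u).

(* Main.v *)
From mathcomp Require Import measurable_realfun.
From mathcomp Require Import ring lra.
Require Import Defs.

Set Implicit Arguments.
Unset Strict Implicit.
Unset Printing Implicit Defensive.

Local Open Scope classical_set_scope.
Local Open Scope ring_scope.

(* Only the resolvents and semigroups matter, the forms play no role.

   From resolvents to semigroups this is the Trotter-Kato argument.  Write G
   and G' for the two resolvents at a, P for Phi n, and D = P G - G' P.  The
   curve s |-> T'(t - s) G' P T(s) G f joins T'(t) G' P G f to G' P T(t) G f
   and has derivative T'(t - s) D T(s) f, so the endpoints are close as soon as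
   D is small along the orbit of f; as the D's are equi-Lipschitz and tend to 0
   pointwise, they are uniformly small on the compact orbit.  Instead of
   differentiating, the increments over a fine grid are summed, using
   T(h) G = exp(a h) G - h + o(h).  The range of G^2 is dense, which gives
   arbitrary initial data.

   From semigroups to resolvents, the resolvent is the Laplace transform of the
   semigroup, and dominated convergence applies.

   Vector-valued integrals are tested against bounded functionals, and orbits
   are extended to negative times as T |t| f, which makes them continuous on
   the whole line. *)

(** * Hilbert spaces and operator norms *)

Section InnerProduct.
Variables (R : realType) (V : hilbertType R).
Implicit Types u v w : V.

Lemma innerDl u v w : inner (u + v) w = inner u w + inner v w.
Proof. by rewrite -[u in u + v]scale1r inner_linear mul1r. Qed.

Lemma inner0l w : inner 0 w = 0.
Proof. by apply: (addrI (inner 0 w)); rewrite -innerDl !addr0. Qed.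

Lemma innerZl a u w : inner (a *: u) w = a * inner u w.
Proof. by rewrite -[a *: u]addr0 inner_linear inner0l addr0. Qed.

Lemma innerBl u v w : inner (u - v) w = inner u w - inner v w.
Proof. by rewrite innerDl -scaleN1r innerZl mulN1r. Qed.

Lemma innerBr u v w : inner w (u - v) = inner w u - inner w v.
Proof. by rewrite !(inner_sym w) innerBl. Qed.

Lemma innerZr a u w : inner w (a *: u) = a * inner w u.
Proof. by rewrite !(inner_sym w) innerZl. Qed.

Lemma cauchy_schwarz u v : `|inner u v| <= `|u| * `|v|.
Proof.
have [->|v0] := eqVneq v 0.
  by rewrite inner_sym inner0l !normr0 mulr0.
have nv0 : 0 < `|v| by rewrite normr_gt0.
rewrite -(@ler_pXn2r _ 2) ?nnegrE ?mulr_ge0 //.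
(* With [c] for [inner u v], this square expands to [|v|^2 (|u|^2 |v|^2 - c^2)]; the factor [|v|^2]
   is then cancelled. *)
have := sqr_ge0 `| `|v| ^+ 2 *: u - inner u v *: v |.
rewrite -inner_norm !(innerBl, innerBr, innerZl, innerZr) !inner_norm.
rewrite (inner_sym v u) real_normK ?num_real // exprMn => h.
rewrite -subr_ge0 -(pmulr_rge0 _ (exprn_gt0 2 nv0)).
by apply: le_trans h _; rewrite le_eqVlt; apply/orP; left; apply/eqP; ring.
Qed.

End InnerProduct.

Section OperatorNorm.
Variables (R : realType) (V W : normedModType R).

(** The supremum is evaluated at [f / |f|]; the null vector is out of its reach and is handled by
    scaling with the factor 0. *)
Lemma opnorm_bound (A : V -> W) (C : R) :
  scalable A -> (opnorm A <= C%:E)%E -> forall f, `|A f| <= C * `|f|.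
Proof.
move=> As AC f; have [->|f0] := eqVneq f 0.
  by rewrite -(scale0r 0) As !scale0r !normr0 mulr0.
have nf0 : 0 < `|f| by rewrite normr_gt0.
have h : ((`|A (`|f|^-1 *: f)|)%:E <= opnorm A)%E.
  apply: ereal_sup_ubound; exists (`|f|^-1 *: f) => //=.
  by rewrite normrZ normfV normr_id mulVf ?normr_eq0.
have := le_trans h AC.
by rewrite lee_fin As normrZ normfV normr_id ler_pdivrMl // mulrC.
Qed.

End OperatorNorm.

(** * Bounded functionals of Bochner integrals *)

Section BochnerFunctional.
Context d (T : measurableType d) (R : realType).
Variable mu : {measure set T -> \bar R}.

(** The integral of a nonnegative function is a supremum over the simple functions below it, so
    monotonicity holds without measurability. *)
Lemma ge0_le_integral_unmeasurable (D : set T) (f g : T -> \bar R) :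
  (forall x, D x -> (0 <= f x)%E) -> (forall x, D x -> (f x <= g x)%E) ->
  (\int[mu]_(x in D) f x <= \int[mu]_(x in D) g x)%E.
Proof.
move=> f0 fg.
have g0 x : D x -> (0 <= g x)%E by move=> Dx; exact: le_trans (f0 _ Dx) (fg _ Dx).
rewrite !ge0_integralE //; apply: le_ereal_sup => _ [h hf <-]; exists h => // x.
apply: le_trans (hf x) _; rewrite /patch; case: ifPn => // /set_mem; exact: fg.
Qed.

Variables (V : normedModType R) (D : set T) (mD : measurable D).
Variables (l : V -> R) (C : R).
Hypotheses (C0 : 0 < C)
  (lL : forall a u v, l (a *: u + v) = a * l u + l v)
  (lC : forall u, `|l u| <= C * `|u|).

Let l0 : l 0 = 0.
Proof.
by apply/normr0_eq0/le_anti; rewrite normr_ge0 (le_trans (lC 0)) // normr0 mulr0.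
Qed.
Let lZ a u : l (a *: u) = a * l u.
Proof. by rewrite -[a *: u]addr0 lL l0 addr0. Qed.
Let lD u v : l (u + v) = l u + l v.
Proof. by rewrite -[u in u + v]scale1r lL mul1r. Qed.
Let lB u v : l (u - v) = l u - l v.
Proof. by rewrite lD -scaleN1r lZ mulN1r. Qed.
Let lS n (F : 'I_n -> V) : l (\sum_(i < n) F i) = \sum_(i < n) l (F i).
Proof. exact: (big_morph l lD l0). Qed.

Let indic_int (A : set T) : measurable A -> (mu A < +oo)%E ->
  mu.-integrable D (EFin \o \1_A).
Proof.
move=> mA Aoo; apply/integrableP; split; first exact/measurable_EFinP.
rewrite (eq_integral (EFin \o \1_A)); last first.
  by move=> x _ /=; rewrite ger0_norm.
rewrite integral_indic //; apply: le_lt_trans Aoo.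
by apply: le_measure; rewrite ?inE //; exact: measurableI.
Qed.

Lemma simple_integral_functional (s : T -> V) (J : V) :
  simple_integral mu D s J ->
  mu.-integrable D (EFin \o (l \o s)) /\
  (\int[mu]_(x in D) l (s x) = l J)%R.
Proof.
move=> [m [A [c [hA sE ->]]]].
have intA i : mu.-integrable D (fun x => (\1_(A i) x * l (c i))%:E).
  have [mA AD Afin] := hA i.
  rewrite (_ : (fun x => _) = (fun x => (l (c i))%:E * (\1_(A i) x)%:E)%E); last first.
    by apply/funext => x; rewrite mulrC EFinM.
  by apply: integrableZl => //; exact: indic_int.
have sE' x : l (s x) = \sum_(i < m) \1_(A i) x * l (c i).
  by rewrite sE lS; apply: eq_bigr => i _; rewrite lZ.
have sE2 : EFin \o (l \o s) =
    (fun x => \sum_(i < m) (\1_(A i) x * l (c i))%:E)%E.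
  by apply/funext => x /=; rewrite sE' sumEFin.
split; first by rewrite sE2; apply: integrable_sum.
rewrite /Rintegral (_ : (fun x => _) = EFin \o (l \o s)) // sE2.
rewrite integral_sum // lS.
under eq_bigr => i _.
  have [mA AD Afin] := hA i.
  rewrite -[integral _ _ _]fineK; last first.
    exact: integrable_fin_num (intA i).
  have -> : fine (\int[mu]_(x in D) (\1_(A i) x * l (c i))%:E) =
      l (fine (mu (A i)) *: c i).
    rewrite -/(Rintegral _ _ _) RintegralZr //; last exact: indic_int.
    by rewrite lZ /Rintegral integral_indic // setIidl.
  over.
by rewrite sumEFin.
Qed.

(** [l \o f] is the L1 limit of the [l \o s k], because [l] is Lipschitz with constant [C], and the
    integrals [l (J k)] of the latter tend to [l I]. *)
Lemma bochner_integral_functional (f : T -> V) (I : V) :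
  measurable_fun D (l \o f) -> bochner_integral mu D f I ->
  mu.-integrable D (EFin \o (l \o f)) /\
  (\int[mu]_(x in D) l (f x) = l I)%R.
Proof.
move=> mlf [s [J [ss _ cvs cvJ]]].
pose e k := (\int[mu]_(x in D) (`|f x - s k x|)%:E)%E.
have sI k := (simple_integral_functional (ss k)).1.
have mls k : measurable_fun D (l \o s k).
  by apply/measurable_EFinP; exact: measurable_int (sI k).
have md k : measurable_fun D (fun x => l (f x) - l (s k x)).
  by move=> *; exact: (measurable_funB mlf (mls k)).
(* The factor [C] stays on the left because [`|f x - s k x|] is not known to be
   measurable. *)
have le k : ((C^-1)%:E * \int[mu]_(x in D) (`|l (f x) - l (s k x)|)%:E <= e k)%E.
  have Ci0 : 0 <= C^-1 by rewrite invr_ge0 ltW.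
  rewrite -ge0_integralZl_EFin //; last first.
    by apply/measurable_EFinP; apply: measurableT_comp.
  apply: ge0_le_integral_unmeasurable => x Dx.
    by rewrite lee_fin mulr_ge0.
  by rewrite lee_fin ler_pdivrMl // -lB lC.
have le' k : (\int[mu]_(x in D) (`|l (f x) - l (s k x)|)%:E <= C%:E * e k)%E.
  by rewrite -lee_pdivrMl.
(* Convergence to 0 in the extended reals makes [e k] finite from some [N] on; the single index [N]
   then yields the integrability of [l \o f]. *)
have /fine_cvgP[[N _ Nfin'] cve] : e k @[k --> \oo] --> 0%:E by [].
have Nfin k : (N <= k)%N -> e k \is a fin_num by exact: Nfin'.
have intd k : (N <= k)%N -> mu.-integrable D (fun x => (l (f x) - l (s k x))%:E).
  move=> /Nfin efin; apply/integrableP; split; first exact/measurable_EFinP.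
  apply: le_lt_trans (le' k) _.
  by rewrite -(fineK efin) -EFinM ltry.
have intf : mu.-integrable D (EFin \o (l \o f)).
  rewrite (_ : _ \o _ = (fun x => (l (f x) - l (s N x))%:E + (l (s N x))%:E)%E).
    by apply: integrableD => //; [exact: intd | exact: sI].
  by apply/funext => x; rewrite /= -EFinD subrK.
split=> //.
set a := Rintegral _ _ _.
have key k : (N <= k)%N -> `|a - l I| <= C * fine (e k) + C * `|J k - I|.
  move=> Nk; have -> : a - l I = (a - l (J k)) + l (J k - I) by rewrite lB; ring.
  apply: le_trans (ler_normD _ _) _; apply: lerD; last exact: lC.
  rewrite -(simple_integral_functional (ss k)).2 -RintegralB //; last exact: sI.
  apply: le_trans (le_normr_Rintegral _ _) _ => //; first exact: intd.
  have efin := Nfin _ Nk.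
  rewrite -lee_fin EFinM [(fine (e k))%:E]fineK //.
  rewrite fineK; first exact: le'.
  rewrite ge0_fin_numE ?integral_ge0 //.
  by have /integrableP[] := intd _ Nk.
apply/eqP; rewrite -subr_eq0 -normr_eq0; apply/eqP.
have: (cst `|a - l I| : nat -> R) @ \oo --> (0 : R).
  have lim0 : (C * fine (e k) + C * `|J k - I|) @[k --> \oo] --> (C * 0 + C * 0 : R).
    apply: cvgD; apply: cvgMr.
      exact: cve.
    by apply/norm_cvg0P; apply/subr_cvg0.
  apply: squeeze_cvgr (@cvg_cst _ (0:R) _ _ _) _; last first.
    by move: lim0; rewrite !mulr0 addr0; exact.
  by exists N => // k /= Nk; rewrite normr_ge0 key.
move/cvg_lim => <- //; by rewrite lim_cst.
Qed.

End BochnerFunctional.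

(** * Scalar integrals on the half line *)

Section HalfLineIntegrals.
Variable R : realType.
Notation mu := (@lebesgue_measure R).

Lemma ge0_integral_shift (k : R -> R) h :
  continuous k -> (forall x, 0 <= k x) ->
  (\int[mu]_(x in `[h, +oo[) (k x)%:E =
   \int[mu]_(x in `[0%R, +oo[) (k (x + h))%:E)%E.
Proof.
move=> ck k0; pose F (x : R) : R := x + h.
have dF : (F^`())%classic = cst 1.
  apply/funext => x; rewrite derive1E deriveD //.
  by rewrite derive_id derive_cst addr0.
have F0 : F 0 = h by rewrite /F add0r.
have cF : continuous F by move=> x; apply: cvgD; [exact: cvg_id|exact: cvg_cst].
rewrite -[in LHS]F0 (@increasing_ge0_integration_by_substitutiony _ F k 0) //.
- by apply: eq_integral => x _ /=; rewrite dF /= mulr1.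
- by move=> x y _ _; rewrite /F ltrD2r.
- by move=> x _; rewrite dF; exact: cvg_cst.
- by rewrite dF; exact: is_cvg_cst.
- by rewrite dF; exact: is_cvg_cst.
- split; first by move=> x _; rewrite /F.
  by apply: cvg_at_right_filter; exact: cF.
- apply/cvgryPge => A; near=> x; rewrite /F -lerBlDr; near: x.
  by apply: nbhs_pinfty_ge; exact: num_real.
- by apply: continuous_subspaceT.
Unshelve. all: by end_near. Qed.

(** The positive and negative parts are shifted separately, so that integrability need not be
    assumed. *)
Lemma Rintegral_shift (k : R -> R) h : continuous k ->
  \int[mu]_(x in `[h, +oo[) k x = \int[mu]_(x in `[0, +oo[) k (x + h).
Proof.
move=> ck; congr fine; rewrite integralE [RHS]integralE.
have cp : continuous (fun x => Num.max (k x) 0).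
  by move=> x; apply: (@continuous_max _ _ k (cst 0)); [exact: ck|exact: cvg_cst].
have cn : continuous (fun x => Num.max (- k x) 0).
  by move=> x; apply: (@continuous_max _ _ (fun x => - k x) (cst 0));
    [apply: cvgN; exact: ck|exact: cvg_cst].
congr (_ - _)%E.
- transitivity (\int[mu]_(x in `[h, +oo[) (Num.max (k x) 0)%:E)%E.
    by apply: eq_integral => x _; rewrite funeposE EFin_max.
  rewrite ge0_integral_shift // => [|x]; last by rewrite le_max lexx orbT.
  by apply: eq_integral => x _; rewrite funeposE EFin_max.
- transitivity (\int[mu]_(x in `[h, +oo[) (Num.max (- k x) 0)%:E)%E.
    by apply: eq_integral => x _; rewrite funenegE EFin_max.
  rewrite ge0_integral_shift // => [|x]; last by rewrite le_max lexx orbT.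
  by apply: eq_integral => x _; rewrite funenegE EFin_max.
Qed.

Lemma Rintegral_shift_split (k : R -> R) h : continuous k -> 0 <= h ->
  mu.-integrable `[0, +oo[ (EFin \o k) ->
  \int[mu]_(x in `[0, +oo[) k (x + h) =
  \int[mu]_(x in `[0, +oo[) k x - \int[mu]_(x in `[0, h]) k x.
Proof.
move=> ck h0 ik; rewrite -Rintegral_shift // Rintegral_itvB ?bnd_simp //.
rewrite Rintegral_itv_obnd_cbnd //.
by apply: integrableS ik => //; apply: subset_itvr; rewrite bnd_simp.
Qed.

Lemma Rintegral_near_cst (k : R -> R) c e h : continuous k -> 0 <= h ->
  (forall x, 0 <= x <= h -> `|k x - c| <= e) ->
  `|\int[mu]_(x in `[0, h]) k x - h * c| <= h * e.
Proof.
move=> ck h0 kc.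
have muh : mu `[0, h] = h%:E.
  by rewrite lebesgue_measure_itv /= lte_fin; case: ltgtP h0 => // [|<-]; rewrite ?sube0.
have ik (g : R -> R) : continuous g -> mu.-integrable `[0, h] (EFin \o g).
  move=> cg; apply: continuous_compact_integrable; first exact: segment_compact.
  exact: continuous_subspaceT.
have ic c' : \int[mu]_(x in `[0, h]) c' = h * c'.
  by rewrite Rintegral_cst //= muh mulrC.
rewrite -!ic -RintegralB //; [|exact: ik..| apply: ik => x; exact: cvg_cst].
have cd : continuous (fun x => k x - c).
  by move=> x; apply: cvgB; [exact: ck|exact: cvg_cst].
apply: le_trans (le_normr_Rintegral _ _) _ => //; first exact: ik.
apply: le_Rintegral => //.
- by apply: ik => x; apply: cvg_norm; exact: cd.
- by apply: ik => x; exact: cvg_cst.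
Qed.

(** Multiplied by [c], the integrand is the density of the exponential law. *)
Lemma integrable_expR_decay (c : R) : 0 < c ->
  mu.-integrable `[0, +oo[ (fun t => (expR (- (c * t)))%:E).
Proof.
move=> c0.
have ip : mu.-integrable `[0, +oo[ (EFin \o exponential_pdf c).
  by apply: integrableS (integrable_exponential_pdf c0).
have : mu.-integrable `[0, +oo[
    (fun x => (c^-1)%:E * (EFin \o exponential_pdf c) x)%E.
  by apply: integrableZl.
apply: eq_integrable => // x; rewrite inE /= in_itv /= andbT => x0.
by rewrite /= exponential_pdfE // -EFinM mulrA mulVf ?gt_eqF // mul1r mulNr.
Qed.

End HalfLineIntegrals.

(** * One semigroup and its resolvent *)

Section Semigroup.
Variables (R : realType) (L : hilbertType R) (alpha0 : R).
Variables (G T : R -> {linear L -> L}).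
Hypothesis semT : associated_semigroup alpha0 G T.
Notation mu := (@lebesgue_measure R).

Lemma semigroup_norm t f : 0 <= t -> `|T t f| <= expR (alpha0 * t) * `|f|.
Proof.
rewrite le_eqVlt => /predU1P[<-|t0].
  by rewrite (semigroup0 semT) mulr0 expR0 mul1r.
have := opnorm_bound _ (semigroup_contraction semT t0) f.
rewrite normrZ (gtr0_norm (expR_gt0 _)) mul1r expRN ler_pdivrMl ?expR_gt0 //.
by apply=> k v; rewrite linearZ /= !scalerA mulrC.
Qed.

(** One constant serves all of [[0, tau]]; the absolute value covers a negative [alpha0]. *)
Lemma semigroup_norm_le t tau f : 0 <= t <= tau ->
  `|T t f| <= expR (`|alpha0| * tau) * `|f|.
Proof.
move=> /andP[t0 tt]; apply: le_trans (semigroup_norm _ t0) _.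
rewrite ler_wpM2r // ler_expR; apply: le_trans (ler_norm _) _.
by rewrite normrM (ger0_norm t0) ler_wpM2l.
Qed.

Lemma semigroup_near0 f e : 0 < e ->
  exists2 d, 0 < d & forall t, 0 <= t < d -> `|T t f - f| <= e.
Proof.
move=> e0; have /cvgrPdist_le/(_ e e0)[d /= d0 H] := @semigroup_continuous _ _ _ _ _ semT f.
exists d => // t /andP[]; rewrite le_eqVlt => /predU1P[<- _|t0 td].
  by rewrite (semigroup0 semT) subrr normr0 ltW.
by rewrite distrC; apply: H; rewrite //= distrC subr0 gtr0_norm.
Qed.

(** Right continuity at 0 suffices: for [s <= t] the increment is [T s (T (t - s) f - f)], and [T s]
    is bounded uniformly for [s] in a bounded interval. *)
Lemma orbit_continuous f : continuous (fun t : R => T `|t| f).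
Proof.
move=> x; apply/cvgrPdist_le => e e0.
have [d d0 H] := semigroup_near0 f (divr_gt0 e0 (expR_gt0 (`|alpha0| * `|x|))).
(* The earlier time [s] is at most [|x|] on whichever side of [x] the other point lies, so [d] can
   be chosen from [x] alone. *)
have incr s t : 0 <= s <= t -> s <= `|x| -> t - s < d ->
    `|T t f - T s f| <= e.
  move=> /andP[s0 st] sx tsd.
  have -> : T t f = T s (T (t - s) f).
    by rewrite -(semigroupD semT) ?subr_ge0 // addrC subrK.
  rewrite -linearB.
  have sx' : 0 <= s <= `|x| by rewrite s0.
  apply: le_trans (semigroup_norm_le _ sx') _.
  by rewrite mulrC -ler_pdivlMr ?expR_gt0 // H // subr_ge0 st.
near=> y; have xyd : `| `|x| - `|y| | < d.
  by apply: le_lt_trans (ler_dist_dist _ _) _; near: y; exact: cvgr_dist_lt.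
have [xy|/ltW yx] := leP `|x| `|y|.
  rewrite distrC; apply: incr; rewrite ?normr_ge0 //.
  by move: xyd; rewrite distrC ger0_norm // subr_ge0.
apply: incr; rewrite ?normr_ge0 //.
by move: xyd; rewrite ger0_norm // subr_ge0.
Unshelve. all: by end_near. Qed.

Section Laplace.
Variables (a : R) (a0 : alpha0 < a) (l : L -> R) (C : R).
Hypotheses (C0 : 0 < C)
  (lL : forall c u v, l (c *: u + v) = c * l u + l v)
  (lC : forall u, `|l u| <= C * `|u|).

Lemma laplace_continuous f :
  continuous (fun t : R => expR (- (a * t)) * l (T `|t| f)).
Proof.
have lB u v : l (u - v) = l u - l v.
  by rewrite addrC -scaleN1r lL mulN1r addrC.
move=> x; apply: cvgM.
  apply: continuous_comp; last exact: continuous_expR.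
  by apply: cvgN; apply: cvgM; [exact: cvg_cst|exact: cvg_id].
apply/cvgrPdist_le => e e0.
have /cvgrPdist_le/(_ (e / C) (divr_gt0 e0 C0)) := @orbit_continuous f x.
apply: filterS => y; rewrite ler_pdivlMr // mulrC -lB.
exact: le_trans (lC _).
Qed.

(** The Bochner integral defining [G a f], tested against [l]. Measurability of the scalar integrand
    comes from continuity of the extended orbit. *)
Lemma laplace_functional f :
  mu.-integrable `[0, +oo[
    (EFin \o (fun t => expR (- (a * t)) * l (T `|t| f))) /\
  \int[mu]_(t in `[0, +oo[) (expR (- (a * t)) * l (T `|t| f)) = l (G a f).
Proof.
pose k t := expR (- (a * t)) * l (T `|t| f).
have l0 : l 0 = 0.
  by apply/normr0_eq0/le_anti; rewrite normr_ge0 (le_trans (lC 0)) // normr0 mulr0.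
have kE : {in `[0, +oo[%classic, (fun t => l (expR (- (a * t)) *: T t f)) =1 k}.
  move=> t; rewrite inE /= in_itv /= andbT => t0.
  by rewrite -[_ *: _]addr0 lL l0 addr0 /k ger0_norm.
have mk : measurable_fun (`[0, +oo[%classic : set (measurableTypeR R)) k.
  by apply: measurable_funTS; apply: continuous_measurable_fun;
     exact: laplace_continuous.
have [|ik <-] := bochner_integral_functional (mu := mu) (measurable_itv _) C0 lL lC _
  (semigroup_resolvent semT a0 f).
  by apply: eq_measurable_fun mk => t /kE /esym.
split; last by apply: eq_Rintegral => t /kE /esym.
by apply: eq_integrable ik => // t tD; congr EFin; exact: kE.
Qed.

End Laplace.

(** These are the three conditions under which [u |-> inner (T h u) v] can be used as the functional
    [l] above; the [+ 1] keeps its constant positive when [v = 0]. *)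
Lemma semigroup_functional h v : 0 <= h ->
  [/\ 0 < expR (alpha0 * h) * `|v| + 1,
      forall c u w, inner (T h (c *: u + w)) v = c * inner (T h u) v + inner (T h w) v &
      forall u, `|inner (T h u) v| <= (expR (alpha0 * h) * `|v| + 1) * `|u|].
Proof.
move=> h0; split; first by rewrite ltr_wpDl // mulr_ge0 // expR_ge0.
  by move=> c u w; rewrite linearP inner_linear.
move=> u; apply: le_trans (cauchy_schwarz _ _) _.
rewrite mulrDl mul1r mulrAC; apply: ler_wpDr => //.
by rewrite ler_wpM2r // semigroup_norm.
Qed.

(** Tested against their difference [v], both sides become the integral of
    [expR (- (a * t)) * inner (T (t + h) f) v]. *)
Lemma resolvent_semigroupC a h f : alpha0 < a -> 0 <= h ->
  T h (G a f) = G a (T h f).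
Proof.
move=> a0 h0; apply/eqP; rewrite -subr_eq0 -normr_eq0 -sqrf_eq0 -inner_norm.
set v := _ - _; rewrite {1}/v innerBl subr_eq0; apply/eqP.
have [C0 lL lC] := semigroup_functional v h0.
have [C0' lL' lC'] := semigroup_functional v (lexx 0).
rewrite -(laplace_functional a0 C0 lL lC f).2.
have := (laplace_functional a0 C0' lL' lC' (T h f)).2.
rewrite (semigroup0 semT) => <-.
apply: eq_Rintegral => t _; rewrite (semigroup0 semT).
by rewrite -!(semigroupD semT) // addrC.
Qed.

(* [expR (a * h) *: G a f - T h (G a f)] is
   \int_0^h expR (a * (h - s)) *: T s f ds. *)
Lemma resolvent_defect_near a h f e : alpha0 < a -> 0 <= h ->
  (forall s, 0 <= s <= h -> `|expR (a * (h - s)) *: T s f - f| <= e) ->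
  `|expR (a * h) *: G a f - T h (G a f) - h *: f| <= h * e.
Proof.
move=> a0 h0 He.
have e0 : 0 <= e by apply: le_trans (normr_ge0 _) (He 0 _); rewrite lexx.
(* The vector to be estimated is its own test vector: [|v|^2] becomes a scalar integral bounded by
   [h * e * |v|], and [|v|] is cancelled at the end. *)
set v := _ - h *: f.
have [C0 lL lC] := semigroup_functional v h0.
have [C0' lL' lC'] := semigroup_functional v (lexx 0).
have [ik Ik] := laplace_functional a0 C0' lL' lC' f.
have ck := laplace_continuous (a := a) C0' lL' lC' (f := f).
pose k t := expR (- (a * t)) * inner (T 0 (T `|t| f)) v.
pose k' t := expR (a * h) * k t.
have ck' : continuous k' by move=> x; apply: cvgM; [exact: cvg_cst|exact: ck].
have ik' : mu.-integrable `[0, +oo[ (EFin \o k').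
  have := @integrableZl _ _ _ mu _ (measurable_itv _) (expR (a * h)) _ ik.
  by apply: eq_integrable => // x _; rewrite /= -EFinM.
(* Applying [T h] under the Laplace integral replaces [k' t] by [k' (t + h)], which loses exactly
   the part of the integral over [[0, h]]. *)
have IT : inner (T h (G a f)) v =
    expR (a * h) * inner (G a f) v - \int[mu]_(t in `[0, h]) k' t.
  have <- : \int[mu]_(t in `[0, +oo[) k t = inner (G a f) v.
    by rewrite Ik (semigroup0 semT).
  rewrite -RintegralZl // -(Rintegral_shift_split ck' h0 ik').
  rewrite -(laplace_functional a0 C0 lL lC f).2.
  apply: eq_Rintegral => t; rewrite inE /= in_itv /= andbT => t0.
  rewrite /k' /k (semigroup0 semT) mulrA -expRD !ger0_norm ?addr_ge0 //.
  by rewrite (addrC t h) (semigroupD semT) //; congr (expR _ * _); ring.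
have vv : `|v| ^+ 2 = \int[mu]_(t in `[0, h]) k' t - h * inner f v.
  by rewrite -inner_norm {1}/v !innerBl !innerZl IT opprB addrCA subrr addr0.
have [->|v0] := eqVneq v 0; first by rewrite normr0 mulr_ge0.
have nv0 : 0 < `|v| by rewrite normr_gt0.
rewrite -(ler_pM2r nv0) -expr2 vv -mulrA; apply: le_trans (ler_norm _) _.
apply: Rintegral_near_cst => // s sh; rewrite /k' /k (semigroup0 semT).
rewrite mulrA -expRD -innerZl -innerBl.
apply: le_trans (cauchy_schwarz _ _) _; rewrite ler_wpM2r //.
have /andP[s0 _] := sh; rewrite ger0_norm //.
by rewrite (_ : a * h + - (a * s) = a * (h - s)) ?He //; ring.
Qed.

End Semigroup.

(** The Lipschitz bound carries smallness at [y t] to all [y s] with [s] near [t], and compactness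
    of [[0, tau]] makes this uniform. The filter is general so as to cover both [h] tending to 0 and
    [n] tending to infinity. *)
Lemma equilipschitz_small_on_curve (R : realType) (V : normedModType R)
    (I : Type) (F : set_system I) (FF : Filter F) (B : I -> V -> R) (C : R)
    (y : R -> V) (tau : R) :
  (\forall i \near F, forall u v, B i u <= B i v + C * `|u - v|) ->
  (forall u e, 0 < e -> \forall i \near F, B i u <= e) ->
  continuous y -> forall e, 0 < e ->
  \forall i \near F, forall t, 0 <= t <= tau -> B i (y t) <= e.
Proof.
move=> BC B0 cy e e0.
have /compact_near_coveringP cpt := @segment_compact R 0 tau.
suff: \near F, (`[0, tau]%classic : set R) `<=` (fun t => B F (y t) <= e).
  by apply: filterS => i H t t0; apply: H; rewrite /= in_itv.
apply: cpt => t _.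
have C1 : 0 < `|C| + 1 by rewrite ltr_wpDl.
near=> s i => /=.
have Bs : B i (y s) <= B i (y t) + C * `|y s - y t|.
  by move: (y s) (y t); near: i.
have Bt : B i (y t) <= e / 2 by near: i; apply: B0; rewrite divr_gt0.
have ys : `|y s - y t| <= e / 2 / (`|C| + 1).
  rewrite distrC; near: s; move/cvgrPdist_le: (cy t); apply; rewrite !divr_gt0 //.
apply: le_trans Bs _; rewrite [leRHS]splitr lerD //.
apply: le_trans (_ : (`|C| + 1) * `|y s - y t| <= _).
  by rewrite ler_wpM2r // (le_trans (ler_norm C)) // lerDl.
by rewrite mulrC -ler_pdivlMr.
Unshelve. all: by end_near. Qed.

(** * First-order expansion of a semigroup on the range of its resolvent *)

Section ResolventDefect.
Variables (R : realType) (L : hilbertType R) (alpha0 : R).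
Variables (G T : R -> {linear L -> L}).
Hypothesis semT : associated_semigroup alpha0 G T.
Variables (a : R) (a0 : alpha0 < a).

(** The remainder in [T h (G a f) = expR (a * h) *: G a f - h *: f + o(h)], up to sign. *)
Definition resolvent_defect h f :=
  expR (a * h) *: G a f - T h (G a f) - h *: f.

Lemma resolvent_defectB h u v :
  resolvent_defect h (u - v) = resolvent_defect h u - resolvent_defect h v.
Proof.
rewrite /resolvent_defect !linearB /=.
by rewrite [RHS]addrACA; congr (_ + _); rewrite addrACA.
Qed.

Lemma resolvent_defect_le : exists2 C, 0 <= C &
  forall h f, 0 <= h <= 1 -> `|resolvent_defect h f| <= h * (C * `|f|).
Proof.
(* For [0 <= s <= h <= 1] the two exponentials bound [expR (a * (h - s))] and [T s]; the [+ 1]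
   accounts for the subtracted [f]. *)
exists (expR `|a| * expR `|alpha0| + 1) => [|h f /andP[h0 h1]].
  by rewrite addr_ge0 // mulr_ge0 // expR_ge0.
apply: (resolvent_defect_near semT) => // s /andP[s0 sh].
apply: le_trans (ler_normB _ _) _; rewrite mulrDl mul1r lerD2r -mulrA.
rewrite normrZ (gtr0_norm (expR_gt0 _)) ler_pM ?expR_ge0 //.
  rewrite ler_expR; apply: le_trans (ler_norm _) _; rewrite normrM ler_piMr //.
  by rewrite ger0_norm; lra.
have s1 : 0 <= s <= 1 by lra.
by have := semigroup_norm_le semT f s1; rewrite mulr1.
Qed.

Lemma resolvent_defect_small f e : 0 < e ->
  \forall h \near 0^'+, `|resolvent_defect h f| <= h * e.
Proof.
move=> e0; have e4 : 0 < e / 4 by rewrite divr_gt0.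
have [d d0 Hd] := semigroup_near0 semT f e4.
have ce : expR (a * r) @[r --> (0 : R)] --> (1 : R).
  have -> : (1 : R) = expR (a * 0) by rewrite mulr0 expR0.
  apply: continuous_comp; last exact: continuous_expR.
  by apply: cvgM; [exact: cvg_cst|exact: cvg_id].
(* Closeness within 1 keeps the exponential factor at most 2; closeness within the second bound
   makes its effect on [f] at most [e / 2]. *)
have m0 : 0 < Num.min 1 (e / 2 / (`|f| + 1)).
  by rewrite lt_min ltr01 !divr_gt0 // ltr_wpDl.
move/cvgrPdist_le : ce => /(_ _ m0)[d' /= d'0 Hd'].
near=> h; have h0 : 0 <= h by near: h; exact: nbhs_right_ge.
have hd : h < d by near: h; exact: nbhs_right_lt.
have hd' : h < d' by near: h; exact: nbhs_right_lt.
apply: (resolvent_defect_near semT) => // s /andP[s0 sh].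
have : `|1 - expR (a * (h - s))| <= Num.min 1 (e / 2 / (`|f| + 1)).
  by apply: Hd'; rewrite /= sub0r normrN ger0_norm; lra.
rewrite le_min => /andP[x1 x2]; set x := expR _ in x1 x2 *.
have -> : x *: T s f - f = x *: (T s f - f) - (1 - x) *: f.
  by rewrite scalerBr scalerBl scale1r opprB addrA subrK.
apply: le_trans (ler_normB _ _) _; rewrite !normrZ.
have -> : e = 2 * (e / 4) + e / 2 by lra.
apply: lerD.
  rewrite ler_pM //; last by apply: Hd; lra.
  by rewrite gtr0_norm ?expR_gt0 //; move: x1; rewrite ler_norml; lra.
apply: le_trans (_ : `|1 - x| * (`|f| + 1) <= _).
  by rewrite ler_wpM2l // lerDl.
by rewrite -ler_pdivlMr // ltr_wpDl.
Unshelve. all: by end_near. Qed.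

(** After division by [h], the defects are equi-Lipschitz for [h <= 1] and tend to 0 pointwise, so
    the compactness argument applies. *)
Lemma resolvent_defect_curve (y : R -> L) tau e : continuous y -> 0 < e ->
  \forall h \near 0^'+, forall t, 0 <= t <= tau ->
    `|resolvent_defect h (y t)| <= h * e.
Proof.
move=> cy e0; have [C C0 HC] := resolvent_defect_le.
suff: \forall h \near 0^'+, forall t, 0 <= t <= tau ->
    h^-1 * `|resolvent_defect h (y t)| <= e.
  apply: filter_app; near=> h => H t /H.
  by rewrite ler_pdivrMl //; near: h; exact: nbhs_right_gt.
apply: (@equilipschitz_small_on_curve _ _ _ _ _
  (fun h u => h^-1 * `|resolvent_defect h u|) C) => //.
  near=> h => u v.
  have h0 : 0 < h by near: h; exact: nbhs_right_gt.
  have h1 : h <= 1 by near: h; exact: nbhs_right_le.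
  rewrite -lerBlDl -mulrBr ler_pdivrMl //.
  apply: le_trans (ler_norm _) _; apply: le_trans (ler_dist_dist _ _) _.
  by rewrite -resolvent_defectB HC // h1 ltW.
move=> u e' e'0; have := resolvent_defect_small u e'0.
by apply: filter_app; near=> h; rewrite ler_pdivrMl.
Unshelve. all: by end_near. Qed.

(** For [g] the quotient [h^-1 *: (expR (a * h) *: f - T h f)], commutation of [G a] with [T h]
    gives [G a g - f = h^-1 *: resolvent_defect h f]. *)
Lemma resolvent_range_dense f e : 0 < e -> exists g, `|G a g - f| <= e.
Proof.
move=> e0; have H := resolvent_defect_small f e0.
near (0 : R)^'+ => h; have h0 : 0 < h by [].
exists (h^-1 *: (expR (a * h) *: f - T h f)).
rewrite linearZ linearB linearZ /= -(resolvent_semigroupC semT _ a0 (ltW h0)).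
have -> : h^-1 *: (expR (a * h) *: G a f - T h (G a f)) - f =
    h^-1 *: resolvent_defect h f.
  by rewrite [RHS]scalerBr scalerK // gt_eqF.
rewrite normrZ gtr0_norm ?invr_gt0 // ler_pdivrMl //.
by near: h.
Unshelve. all: by end_near. Qed.

End ResolventDefect.

(** * Comparing two semigroups *)

Lemma subrACA (V : zmodType) (x y z t : V) :
  x - y - (z - t) = x - z - (y - t).
Proof. by rewrite !opprD !opprK addrACA. Qed.

Section TwoSemigroups.
Variables (R : realType) (L L' : hilbertType R) (alpha0 : R).
Variables (G T : R -> {linear L -> L}) (G' T' : R -> {linear L' -> L'}).
Hypotheses (semT : associated_semigroup alpha0 G T)
  (semT' : associated_semigroup alpha0 G' T').
Variables (P : {linear L -> L'}) (M K : R).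
Hypotheses (M0 : 0 <= M) (PM : forall f, `|P f| <= M * `|f|).
Variables (a : R) (a0 : alpha0 < a).
Hypotheses (K0 : 0 <= K) (GK : forall f, `|G a f| <= K * `|f|)
  (GK' : forall f, `|G' a f| <= K * `|f|).

Definition intertwining_defect f := P (G a f) - G' a (P f).

(** The defect is linear, and its bound [2 * M * K] depends only on constants that will be common to
    all [n]. *)
Lemma intertwining_defect_lipschitz u v :
  `|intertwining_defect u| <= `|intertwining_defect v| + 2 * M * K * `|u - v|.
Proof.
have DB : intertwining_defect (u - v) = intertwining_defect u - intertwining_defect v.
  by rewrite /intertwining_defect !linearB /= addrACA.
rewrite -lerBlDl; apply: le_trans (ler_norm _) _.
apply: le_trans (ler_dist_dist _ _) _; rewrite -DB.
apply: le_trans (ler_normB _ _) _.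
have -> : 2 * M * K * `|u - v| = M * (K * `|u - v|) + K * (M * `|u - v|) by ring.
apply: lerD.
  by apply: le_trans (PM _) _; rewrite ler_wpM2l.
by apply: le_trans (GK' _) _; rewrite ler_wpM2l.
Qed.

(** Both [T h (G a g)] and [T' h (G' a (P (G a g)))] are expanded to first order; the terms
    [expR (a * h) *: G' a (P (G a g))] cancel. *)
Let step h g :
  G' a (P (T h (G a g))) - T' h (G' a (P (G a g))) =
  h *: intertwining_defect g + resolvent_defect G' T' a h (P (G a g))
  - G' a (P (resolvent_defect G T a h g)).
Proof.
have aux (x y w p e : L') : w - p + (e - y - w) - (e - x - p) = x - y.
  rewrite [w - p + _]addrC addrA subrK subrACA subrr subr0 subrACA subrr sub0r.
  by rewrite opprB.
rewrite /intertwining_defect /resolvent_defect scalerBr.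
have -> : G' a (P (expR (a * h) *: G a g - T h (G a g) - h *: g)) =
    expR (a * h) *: G' a (P (G a g)) - G' a (P (T h (G a g))) - h *: G' a (P g).
  by rewrite !(linearB, linearZ).
by rewrite aux.
Qed.

(** Each increment over a grid of mesh [h] is [T'] of the remaining time applied to the expression
    in [step], hence of size at most [C * (h * (e + 2 * del))]. The increments telescope, and [del]
    is arbitrarily small. *)
Lemma intertwining_bound f tau e : 
  (forall s, 0 <= s <= tau -> `|intertwining_defect (T s f)| <= e) ->
  forall t, 0 <= t <= tau ->
  `|G' a (P (T t (G a f))) - T' t (G' a (P (G a f)))| <=
  expR (`|alpha0| * tau) * (t * e).
Proof.
move=> De t /andP[]; rewrite le_eqVlt => /predU1P[<- _|t0 ttau].
  by rewrite (semigroup0 semT) (semigroup0 semT') subrr normr0 mul0r mulr0.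
set C := expR _; have C0 : 0 < C := expR_gt0 _.
apply/ler_addgt0Pr => eps eps0.
(* Chosen so that [C * (t * (2 * del)) = eps]. *)
pose del := eps / (2 * C * t).
have del0 : 0 < del by rewrite divr_gt0 // !mulr_gt0.
(* The defect of [T] is later hit by [G' a] and [P], which costs a factor [K * M]; it is therefore
   made smaller than [del] by this margin. *)
have K1 : 0 < K * M + 1 by rewrite ltr_wpDl // mulr_ge0.
have cT := orbit_continuous semT (f := f).
have cPT : continuous (fun s : R => P (G a (T `|s| f))).
  move=> s; apply/cvgrPdist_le => r r0.
  have MK1 : 0 < M * K + 1 by rewrite ltr_wpDl // mulr_ge0.
  move/cvgrPdist_le : (cT s) => /(_ _ (divr_gt0 r0 MK1)).
  apply: filterS => s'; rewrite ler_pdivlMr // => H; rewrite -!linearB /=.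
  apply: le_trans (PM _) _; apply: le_trans (ler_wpM2l M0 (GK _)) _.
  by apply: le_trans H; rewrite mulrA mulrC ler_wpM2l // lerDl.
have H1 := resolvent_defect_curve semT a0 tau cT (divr_gt0 del0 K1).
have H2 := resolvent_defect_curve semT' a0 tau cPT del0.
have [d /= d0 Hd] := filterI H1 H2.
(* Enough steps to bring the mesh [t / N] below [d], where both defects are under control. *)
pose N := Num.bound (t / d).
have td0 : 0 < t / d by rewrite divr_gt0.
have tdN : t / d < N%:R by apply: archi_boundP; exact: ltW.
have N0 : 0 < N%:R :> R by exact: lt_trans tdN.
pose h := t / N%:R.
have h0 : 0 < h by rewrite divr_gt0.
have hd : h < d by move: tdN; rewrite /h ltr_pdivrMr // ltr_pdivrMr // mulrC.
have [Hh1 Hh2] : (forall s, 0 <= s <= tau ->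
     `|resolvent_defect G T a h (T `|s| f)| <= h * (del / (K * M + 1))) /\
   (forall s, 0 <= s <= tau ->
     `|resolvent_defect G' T' a h (P (G a (T `|s| f)))| <= h * del).
  by apply: Hd => //=; rewrite sub0r normrN gtr0_norm.
have hN : N%:R * h = t by rewrite mulrC divfK ?gt_eqF.
(* The curve sampled on the grid: since [N%:R * h = t], [phi 0] and [phi N] are the two vectors to
   be compared. *)
pose phi k := T' (t - k%:R * h) (G' a (P (T (k%:R * h) (G a f)))).
have kt k : (k <= N)%N -> k%:R * h <= t.
  by move=> kN; rewrite -hN ler_pM2r // ler_nat.
have phiS k : (k < N)%N -> `|phi k.+1 - phi k| <= C * (h * (e + 2 * del)).
  move=> kN; have r0 : 0 <= t - k.+1%:R * h by rewrite subr_ge0 kt.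
  have s0 : 0 <= k%:R * h by rewrite mulr_ge0 // ltW.
  have stau : 0 <= k%:R * h <= tau by rewrite s0 (le_trans (kt _ (ltnW kN))).
  (* A factor [T' h] is split off in [phi k] and a factor [T h] in [phi k.+1], and [G a] is commuted
     past [T (k%:R * h)]. *)
  have -> : phi k.+1 - phi k = T' (t - k.+1%:R * h)
      (G' a (P (T h (G a (T (k%:R * h) f)))) -
       T' h (G' a (P (G a (T (k%:R * h) f))))).
    rewrite linearB /= -(semigroupD semT') ?(ltW h0) //; congr (_ - _).
      rewrite /phi; congr (T' _ (G' a (P _))).
      rewrite (_ : k.+1%:R * h = h + k%:R * h); last by rewrite -natr1; ring.
      by rewrite (semigroupD semT) ?(ltW h0) // (resolvent_semigroupC semT).
    rewrite /phi -(resolvent_semigroupC semT _ a0 s0).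
    by congr (T' _ _); rewrite -natr1; ring.
  rewrite step.
  have rtau : 0 <= t - k.+1%:R * h <= tau.
    by rewrite r0 (le_trans _ ttau) // gerBl mulr_ge0 // ltW.
  apply: le_trans (semigroup_norm_le semT' _ rtau) _; rewrite ler_pM2l //.
  apply: le_trans (ler_normB _ _) _.
  rewrite (_ : h * _ = h * e + h * del + h * del); last by ring.
  have := Hh1 _ stau; have := Hh2 _ stau; rewrite ger0_norm // => h2 h1.
  apply: lerD.
    apply: le_trans (ler_normD _ _) _; apply: lerD => //.
    by rewrite normrZ gtr0_norm // ler_pM2l // De.
  apply: le_trans (GK' _) _; apply: le_trans (ler_wpM2l K0 (PM _)) _.
  rewrite mulrA; apply: le_trans (_ : (K * M + 1) * (h * (del / (K * M + 1))) <= _).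
    by rewrite ler_pM ?mulr_ge0 // lerDl.
  by rewrite mulrCA [(_ + 1) * _]mulrC divfK // gt_eqF.
have phik k : (k <= N)%N -> `|phi k - phi 0%N| <= k%:R * (C * (h * (e + 2 * del))).
  elim: k => [_|k IH kN]; first by rewrite subrr normr0 mul0r.
  rewrite -[phi k.+1](subrK (phi k)) -addrA; apply: le_trans (ler_normD _ _) _.
  by rewrite -nat1r mulrDl mul1r lerD ?phiS // IH // ltnW.
have := phik N (leqnn N); rewrite /phi hN mul0r subrr subr0.
rewrite (semigroup0 semT) (semigroup0 semT') => /le_trans; apply.
rewrite (_ : N%:R * _ = C * (N%:R * h * (e + 2 * del))); last by ring.
rewrite hN le_eqVlt; apply/orP; left; apply/eqP.
rewrite /del; field; rewrite !gt_eqF //.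
Qed.

End TwoSemigroups.

(** * Comparing two resolvents through their Laplace representations *)

Section LaplaceDifference.
Variables (R : realType) (L L' : hilbertType R) (alpha0 : R).
Variables (G T : R -> {linear L -> L}) (G' T' : R -> {linear L' -> L'}).
Hypotheses (semT : associated_semigroup alpha0 G T)
  (semT' : associated_semigroup alpha0 G' T').
Variables (P : {linear L -> L'}) (M : R).
Hypotheses (M0 : 0 <= M) (PM : forall f, `|P f| <= M * `|f|).
Variables (a : R) (a0 : alpha0 < a).
Notation mu := (@lebesgue_measure R).

Definition laplace_gap f g (t : R) :=
  expR (- (a * t)) * `|T' `|t| g - P (T `|t| f)|.

Lemma laplace_gap_continuous f g : continuous (laplace_gap f g).
Proof.
move=> t; apply: cvgM.
  apply: continuous_comp; last exact: continuous_expR.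
  by apply: cvgN; apply: cvgM; [exact: cvg_cst|exact: cvg_id].
apply: cvg_norm; apply: cvgB; first exact: (orbit_continuous semT').
have M1 : 0 < M + 1 by rewrite ltr_wpDl.
apply/cvgrPdist_le => e e0.
have /cvgrPdist_le/(_ _ (divr_gt0 e0 M1)) := @orbit_continuous _ _ _ _ _ semT f t.
apply: filterS => s; rewrite ler_pdivlMr // => H; rewrite -linearB /=.
apply: le_trans (PM _) _; apply: le_trans H.
by rewrite mulrC ler_wpM2l // lerDl.
Qed.

Lemma laplace_gap_le f g t : 0 <= t ->
  laplace_gap f g t <= (`|g| + M * `|f|) * expR (- ((a - alpha0) * t)).
Proof.
move=> t0; rewrite /laplace_gap ger0_norm //.
have -> : expR (- ((a - alpha0) * t)) = expR (- (a * t)) * expR (alpha0 * t).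
  by rewrite -expRD; congr expR; ring.
rewrite mulrCA ler_wpM2l ?expR_ge0 //.
apply: le_trans (ler_normB _ _) _; rewrite mulrDl; apply: lerD.
  by rewrite mulrC; exact: (semigroup_norm semT').
apply: le_trans (PM _) _; rewrite -mulrA ler_wpM2l // mulrC.
exact: (semigroup_norm semT).
Qed.

Lemma laplace_gap_integrable f g :
  mu.-integrable `[0, +oo[ (EFin \o laplace_gap f g).
Proof.
have c0 : 0 < a - alpha0 by rewrite subr_gt0.
have := @integrableZl _ _ _ mu _ (measurable_itv _) (`|g| + M * `|f|) _
  (integrable_expR_decay c0).
apply: le_integrable => //.
  apply/measurable_EFinP; apply: measurable_funTS; apply: continuous_measurable_fun.
  exact: laplace_gap_continuous.
move=> t; rewrite /= in_itv /= andbT => t0.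
rewrite lee_fin ger0_norm; last by rewrite mulr_ge0 ?expR_ge0.
exact: le_trans (laplace_gap_le _ _ t0) (ler_norm _).
Qed.

(** With the difference [v] as its own test vector, [|v|^2] is a scalar Laplace integral, at most
    [|v|] times the right-hand side by Cauchy-Schwarz. *)
Lemma resolvent_gap_le f g :
  `|G' a g - P (G a f)| <= \int[mu]_(t in `[0, +oo[) laplace_gap f g t.
Proof.
set v := G' a g - P (G a f).
have I0 : 0 <= \int[mu]_(t in `[0, +oo[) laplace_gap f g t.
  by apply: Rintegral_ge0 => t _; rewrite mulr_ge0 ?expR_ge0.
have [->|v0] := eqVneq v 0; first by rewrite normr0.
have nv0 : 0 < `|v| by rewrite normr_gt0.
have lL (c : R) (u w : L') : inner (c *: u + w) v = c * inner u v + inner w v.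
  exact: inner_linear.
have lL' (c : R) (u w : L) :
    inner (P (c *: u + w)) v = c * inner (P u) v + inner (P w) v.
  by rewrite linearP inner_linear.
have lC (u : L') : `|inner u v| <= `|v| * `|u|.
  by rewrite mulrC; exact: cauchy_schwarz.
have C0 : 0 < (M + 1) * `|v| by rewrite mulr_gt0 // ltr_wpDl.
have lC' (u : L) : `|inner (P u) v| <= (M + 1) * `|v| * `|u|.
  apply: le_trans (cauchy_schwarz _ _) _; rewrite mulrAC ler_wpM2r //.
  by apply: le_trans (PM _) _; rewrite ler_wpM2r // lerDl.
have [i1 I1] := laplace_functional semT' a0 nv0 lL lC g.
have [i2 I2] := laplace_functional semT a0 C0 lL' lC' f.
rewrite -(ler_pM2r nv0) -expr2 -inner_norm {1}/v innerBl -I1 -I2.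
rewrite -RintegralB // -RintegralZr //; last exact: laplace_gap_integrable.
apply: le_Rintegral => //.
- have := @integrableB _ _ _ mu _ (measurable_itv _) _ _ i1 i2.
  by apply: eq_integrable => // t _; rewrite /= EFinB.
- have := @integrableZr _ _ _ mu _ (measurable_itv _) `|v| _ (laplace_gap_integrable f g).
  by apply: eq_integrable => // t _; rewrite /= EFinM.
move=> t _; rewrite -mulrBr -innerBl -mulrA ler_wpM2l ?expR_ge0 //.
exact: le_trans (ler_norm _) (cauchy_schwarz _ _).
Qed.

End LaplaceDifference.

(** * Varying spaces *)

Lemma resolvent_norm (R : realType) (L : hilbertType R) (alpha0 : R) (H : set L)
    (E : L -> L -> R) (G : R -> {linear L -> L}) (a : R) :
  associated_resolvent alpha0 H E G -> alpha0 < a ->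
  forall f, `|G a f| <= (a - alpha0)^-1 * `|f|.
Proof.
move=> resG a0 f; have aa0 : 0 < a - alpha0 by rewrite subr_gt0.
have := opnorm_bound _ (resolvent_contraction resG a0) f.
rewrite normrZ gtr0_norm // mul1r ler_pdivlMl //; apply=> k v.
by rewrite linearZ /= !scalerA mulrC.
Qed.

Lemma uniformly_bounded_opnorm (R : realType) (V : normedModType R)
    (W : nat -> normedModType R) (A : forall n, {linear V -> W n}) :
  (ereal_sup (range (fun n => opnorm (A n))) < +oo)%E ->
  exists2 M : R, 0 <= M & forall n f, `|A n f| <= M * `|f|.
Proof.
set s := ereal_sup _ => soo.
exists `|fine s| => // n f.
have sA : (opnorm (A n) <= s)%E by apply: ereal_sup_ubound; exists n.
have As : scalable (A n) by move=> k v; rewrite linearZ.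
apply: (opnorm_bound As); apply: le_trans sA _.
(* If [V] is null, [s] is [-oo]; its [fine] value 0 is then still an upper bound. *)
move: soo; case: s => [r _| //|_] /=; last by rewrite leNye.
by rewrite lee_fin ler_norm.
Qed.

Section VaryingSpaces.
Variables (R : realType) (L : hilbertType R) (Ln : nat -> hilbertType R).
Variables (Phi : forall n, {linear L -> Ln n}) (M : R).
Hypotheses (M0 : 0 <= M) (PhiM : forall n f, `|Phi n f| <= M * `|f|).
Variable alpha0 : R.
Variables (G T : R -> {linear L -> L}) (Gn Tn : forall n, R -> {linear Ln n -> Ln n}).
Hypotheses (semT : associated_semigroup alpha0 G T)
  (semTn : forall n, associated_semigroup alpha0 (Gn n) (Tn n)).
Variables (a K : R) (a0 : alpha0 < a) (K0 : 0 <= K).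
Hypotheses (GK : forall f, `|G a f| <= K * `|f|)
  (GnK : forall n f, `|Gn n a f| <= K * `|f|).

Lemma resolvent_cvg_of_semigroup_cvg :
  (forall t, 0 <= t -> op_strong_cvg Phi (fun n => Tn n t) (T t)) ->
  op_strong_cvg Phi (fun n => Gn n a) (G a).
Proof.
move=> cT fn f cf; rewrite /strong_cvg.
(* [fn] is bounded, being at bounded distance from [Phi n f]; [B] provides a dominating function
   independent of [n]. *)
have [B HB] : exists B, forall n, `|fn n| + M * `|f| <= B.
  have bf : bounded_fun (fun n => `|Phi n f - fn n|).
    by apply: cvg_seq_bounded; apply: cvgP cf.
  have [B HB] := bounded_fun_has_ubound bf.
  exists (B + M * `|f| + M * `|f|) => n; rewrite lerD2r.
  rewrite -[fn n](subKr (Phi n f)); apply: le_trans (ler_normB _ _) _.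
  by rewrite addrC lerD //; apply: HB; exists n.
pose gap n t := (laplace_gap T (Tn n) (Phi n) a f (fn n) t)%:E.
have c0 : 0 < a - alpha0 by rewrite subr_gt0.
have ig : (@lebesgue_measure R).-integrable `[0, +oo[
    (fun t => (B * expR (- ((a - alpha0) * t)))%:E).
  have := @integrableZl _ _ _ (@lebesgue_measure R) _ (measurable_itv _) B _
    (integrable_expR_decay c0).
  by apply: eq_integrable => // t _; rewrite EFinM.
have [|||//||_ _ /=] := @dominated_convergence _ _ _ (@lebesgue_measure R) `[0, +oo[
  (measurable_itv _) gap (cst 0%E) (fun t => (B * expR (- ((a - alpha0) * t)))%:E).
- move=> n; apply/measurable_EFinP; apply: measurable_funTS.
  apply: continuous_measurable_fun.
  exact: (laplace_gap_continuous semT (semTn n) M0 (PhiM n)).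
- exact: measurable_cst.
- apply: aeW => t; rewrite /= in_itv /= andbT => t0.
  apply/cvg_EFin; first exact: nearW.
  rewrite -[0 in X in _ --> X](mulr0 (expR (- (a * t)))); apply: cvgMr.
  have := cT t t0 fn f cf; rewrite /strong_cvg ger0_norm //.
  by under eq_fun do rewrite distrC.
- apply: aeW => t n; rewrite /= in_itv /= andbT => t0.
  rewrite lee_fin ger0_norm ?mulr_ge0 ?expR_ge0 //.
  apply: le_trans (laplace_gap_le semT (semTn n) M0 (PhiM n) _ _ _ t0) _.
  by rewrite ler_wpM2r ?expR_ge0 ?HB.
rewrite integral0 => /fine_cvgP[_ lim0].
apply: squeeze_cvgr (@cvg_cst _ (0:R) _ _ _) lim0.
apply: nearW => n; rewrite normr_ge0 /= distrC.
exact: (resolvent_gap_le semT (semTn n) M0 (PhiM n)).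
Qed.

Hypothesis cG : op_strong_cvg Phi (fun n => Gn n a) (G a).

Let D n := intertwining_defect G (Gn n) (Phi n) a.

(** This is the convergence of resolvents along the sequence [Phi n f], which trivially converges
    strongly to [f]. *)
Let intertwining_defect_cvg f e : 0 < e -> \forall n \near \oo, `|D n f| <= e.
Proof.
move=> e0; have /cG : strong_cvg Phi (fun n => Phi n f) f.
  by rewrite /strong_cvg; under eq_fun do rewrite subrr normr0; exact: cvg_cst.
move=> /cvgrPdist_le/(_ _ e0); apply: filterS => n.
by rewrite sub0r normrN normr_id.
Qed.

Let intertwining_defect_cvg_orbit f tau e : 0 < e ->
  \forall n \near \oo, forall t, 0 <= t <= tau -> `|D n (T t f)| <= e.
Proof.
move=> e0; have cT := orbit_continuous semT (f := f).
have := @equilipschitz_small_on_curve _ _ _ \oo _ (fun n u => `|D n u|)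
  (2 * M * K) _ tau _ intertwining_defect_cvg cT _ e0.
case=> [|N _ HN].
  apply: nearW => n u v.
  exact: (intertwining_defect_lipschitz M0 (PhiM n) K0 GK (@GnK n)).
exists N => // n Nn t /[dup] t0 /andP[t00 _].
by have := HN n Nn t t0; rewrite ger0_norm.
Qed.

(** The outer [G a] is moved across [Phi n] before and after the evolution, at the cost of [D n] at
    [G a g] and at [T t (G a g)]; the inner one gives the remaining term the shape treated by
    [intertwining_bound]. *)
Let semigroup_cvg_range2 tau g e : 0 < e ->
  \forall n \near \oo, forall t, 0 <= t <= tau ->
    `|Tn n t (Phi n (G a (G a g))) - Phi n (T t (G a (G a g)))| <= e.
Proof.
move=> e0; set C := expR (`|alpha0| * tau); have C0 : 0 < C := expR_gt0 _.
have [tau0|tau0] := ltP tau 0.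
  apply: nearW => n t /andP[t0 t1].
  by have := le_lt_trans (le_trans t0 t1) tau0; rewrite ltxx.
have S0 : 0 < C + C * tau + 1 by rewrite ltr_wpDl // addr_ge0 ?mulr_ge0 // ltW.
(* The three summands of the denominator match the three error terms, bounded by [C * e1],
   [C * (tau * e1)] and [e1]. *)
pose e1 := e / (C + C * tau + 1); have e10 : 0 < e1 by rewrite divr_gt0.
near=> n => t tt; have /andP[t0 ttau] := tt.
have H1 : `|D n (G a g)| <= e1 by near: n; exact: intertwining_defect_cvg.
have H2 : `|D n (T t (G a g))| <= e1.
  by move: t tt {t0 ttau}; near: n; exact: intertwining_defect_cvg_orbit.
have H3 s : 0 <= s <= tau -> `|D n (T s g)| <= e1.
  by move: s; near: n; exact: intertwining_defect_cvg_orbit.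
have H4 := intertwining_bound semT (semTn n) M0 (PhiM n) a0 K0 GK (@GnK n) H3 tt.
rewrite (_ : _ - _ = Tn n t (D n (G a g)) +
  (Tn n t (Gn n a (Phi n (G a g))) - Gn n a (Phi n (T t (G a g)))) -
  D n (T t (G a g))); last first.
  rewrite /D /intertwining_defect linearB /= addrA subrK opprB addrA subrK.
  by rewrite (resolvent_semigroupC semT).
apply: le_trans (ler_normB _ _) _.
rewrite (_ : e = C * e1 + C * (tau * e1) + e1); last first.
  by rewrite /e1; field; rewrite gt_eqF.
apply: lerD => //; apply: le_trans (ler_normD _ _) _; apply: lerD.
  by apply: le_trans (semigroup_norm_le (semTn n) _ tt) _; rewrite ler_pM2l.
rewrite distrC; apply: le_trans H4 _; rewrite ler_pM2l // ler_wpM2r //.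
exact: ltW.
Unshelve. all: by end_near. Qed.

(** The limit [f] is replaced by a nearby [f'] in the range of the squared resolvent; the uniform
    bounds on [Tn n], [T] and [Phi n] control both this replacement and that of [fn n] by
    [Phi n f]. *)
Lemma semigroup_cvg_uniform (fn : forall n, Ln n) f tau e :
  strong_cvg Phi fn f -> 0 < e ->
  \forall n \near \oo, forall t, 0 <= t <= tau ->
    `|Tn n t (fn n) - Phi n (T t f)| <= e.
Proof.
move=> cf e0; set C := expR (`|alpha0| * tau); have C0 : 0 < C := expR_gt0 _.
have e3 : 0 < e / 3 by rewrite divr_gt0.
have S0 : 0 < 2 * C * M * (K + 1) + 1.
  by rewrite ltr_wpDl // !mulr_ge0 ?addr_ge0 // ltW.
(* Both evolutions of [f' - f] have norm at most [C * M * ((K + 1) * eta)], so together they stay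
   below [e / 3]. *)
pose eta := e / 3 / (2 * C * M * (K + 1) + 1).
have eta0 : 0 < eta by rewrite divr_gt0.
(* Density is used twice: [G a g1] is near [f] and [G a g] is near [g1], with total error at most
   [eta + K * eta]. *)
have [g1 Hg1] := resolvent_range_dense semT a0 f eta0.
have [g Hg] := resolvent_range_dense semT a0 g1 eta0.
set f' := G a (G a g).
have ff' : `|f' - f| <= (K + 1) * eta.
  rewrite /f' -(subrK (G a g1) (G a (G a g))) -addrA -linearB mulrDl mul1r.
  apply: le_trans (ler_normD _ _) _; apply: lerD => //.
  by apply: le_trans (GK _) _; rewrite ler_wpM2l.
near=> n => t tt; have /andP[t0 _] := tt.
have H1 : `|Phi n f - fn n| <= e / 3 / C.
  near: n; move/cvgrPdist_le : cf => /(_ _ (divr_gt0 e3 C0)).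
  by apply: filterS => n; rewrite sub0r normrN normr_id.
have H2 : `|Tn n t (Phi n f') - Phi n (T t f')| <= e / 3.
  by move: t tt {t0}; near: n; exact: semigroup_cvg_range2.
rewrite (_ : _ - _ = (Tn n t (Phi n f') - Phi n (T t f')) +
  (Phi n (T t (f' - f)) - Tn n t (Phi n (f' - f))) - Tn n t (Phi n f - fn n)); last first.
  have aux (x y z w p : Ln n) : x - y + (y - z - (x - w)) - (w - p) = p - z.
    rewrite subrACA addrA -[x - y]opprB addNr sub0r opprB.
    by rewrite subrACA subrr sub0r opprB.
  have -> : Phi n (T t (f' - f)) = Phi n (T t f') - Phi n (T t f) by rewrite !linearB.
  have -> : Tn n t (Phi n (f' - f)) = Tn n t (Phi n f') - Tn n t (Phi n f).
    by rewrite !linearB.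
  have -> : Tn n t (Phi n f - fn n) = Tn n t (Phi n f) - Tn n t (fn n).
    by rewrite linearB.
  by rewrite aux.
rewrite (_ : e = e / 3 + e / 3 + e / 3); last lra.
apply: le_trans (ler_normB _ _) _; apply: lerD; last first.
  apply: le_trans (semigroup_norm_le (semTn n) _ tt) _.
  apply: le_trans (ler_wpM2l (ltW C0) H1) _.
  by rewrite [C * _]mulrC divfK // gt_eqF.
apply: le_trans (ler_normD _ _) _; apply: lerD => //.
have Cff : C * M * `|f' - f| <= C * M * ((K + 1) * eta).
  by rewrite ler_wpM2l // mulr_ge0 // ltW.
apply: le_trans (_ : 2 * (C * M * `|f' - f|) <= _).
  rewrite mulr2n mulrDl !mul1r; apply: le_trans (ler_normB _ _) _; apply: lerD.
    apply: le_trans (PhiM _ _) _; rewrite [C * M]mulrC -mulrA ler_wpM2l //.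
    exact: (semigroup_norm_le semT).
  apply: le_trans (semigroup_norm_le (semTn n) _ tt) _.
  by rewrite -mulrA ler_pM2l // PhiM.
apply: le_trans (_ : 2 * (C * M * ((K + 1) * eta)) <= _); first by rewrite ler_pM2l.
apply: le_trans (_ : (2 * C * M * (K + 1) + 1) * eta <= _); last first.
  by rewrite /eta mulrC divfK // gt_eqF.
by rewrite [leRHS]mulrDl mul1r; apply: ler_wpDr; [exact: ltW|]; rewrite !mulrA.
Unshelve. all: by end_near. Qed.

End VaryingSpaces.

Theorem theorem3p9 (R : realType)
    (L : hilbertType R) (Ln : nat -> hilbertType R)
    (sepL : separable L) (sepLn : forall n, separable (Ln n))
    (Phi : forall n, {linear L -> Ln n})
    (Phi_norm : forall u : L, `|Phi n u| @[n --> \oo] --> `|u|)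
    (alpha0 : R)
    (H : set L) (E : L -> L -> R)
    (formE : bilinear_closed_form alpha0 H E)
    (Hn : forall n, set (Ln n)) (En : forall n, Ln n -> Ln n -> R)
    (formEn : forall n, bilinear_closed_form alpha0 (Hn n) (En n))
    (G : R -> {linear L -> L}) (T : R -> {linear L -> L})
    (resG : associated_resolvent alpha0 H E G)
    (semT : associated_semigroup alpha0 G T)
    (Gn : forall n, R -> {linear Ln n -> Ln n})
    (Tn : forall n, R -> {linear Ln n -> Ln n})
    (resGn : forall n, associated_resolvent alpha0 (Hn n) (En n) (Gn n))
    (semTn : forall n, associated_semigroup alpha0 (Gn n) (Tn n))
    (Phi_bounded : (ereal_sup (range (fun n => opnorm (Phi n))) < +oo)%E) :
  [<-> exists2 alpha : R, alpha0 < alpha &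
         op_strong_cvg Phi (fun n => Gn n alpha) (G alpha);
       forall t : R, 0 <= t ->
         op_strong_cvg Phi (fun n => Tn n t) (T t);
       forall tmax : R, 0 < tmax -> forall (fn : forall n, Ln n) (f : L),
         strong_cvg Phi fn f ->
         ereal_sup [set (`|Tn n t (fn n) - Phi n (T t f)|)%:E
                     | t in [set` `[0, tmax]]] @[n --> \oo] --> 0%E].
Proof.
have [M M0 PhiM] := uniformly_bounded_opnorm Phi_bounded.
pose K a : R := (a - alpha0)^-1.
have K0 a : alpha0 < a -> 0 <= K a by move=> a0; rewrite invr_ge0 subr_ge0 ltW.
have uniform a tmax (fn : forall n, Ln n) f e : alpha0 < a ->
    op_strong_cvg Phi (fun n => Gn n a) (G a) ->
    strong_cvg Phi fn f -> 0 < e -> \forall n \near \oo,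
    forall t, 0 <= t <= tmax -> `|Tn n t (fn n) - Phi n (T t f)| <= e.
  move=> a0 cG cf e0.
  exact: (semigroup_cvg_uniform M0 PhiM semT semTn a0 (K0 a a0)
    (resolvent_norm resG a0) (fun n => resolvent_norm (resGn n) a0) cG).
have cvg_resolvent : (forall t : R, 0 <= t ->
    op_strong_cvg Phi (fun n => Tn n t) (T t)) ->
    exists2 alpha : R, alpha0 < alpha &
      op_strong_cvg Phi (fun n => Gn n alpha) (G alpha).
  move=> cT; have a0 : alpha0 < alpha0 + 1 by rewrite ltrDl.
  exists (alpha0 + 1) => //.
  exact: (resolvent_cvg_of_semigroup_cvg M0 PhiM semT semTn a0).
(* The implications are proved in a cycle, each passing through convergence of a resolvent:
   [uniform] starts from it and [cvg_resolvent] ends with it. *)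
tfae.
- move=> [a a0 cG] t t0 fn f cf; apply/cvgrPdist_le => e e0.
  have := uniform a t fn f e a0 cG cf e0; apply: filterS => n Un.
  by rewrite sub0r normrN normr_id distrC Un // t0 lexx.
- move=> /cvg_resolvent[a a0 cG] tmax tmax0 fn f cf.
  set s := fun n => ereal_sup _.
  (* The time 0 belongs to the interval, so the supremum is not over the empty set and cannot be
     [-oo]. *)
  have s0 n : (0 <= s n)%E.
    apply: le_ereal_sup_tmp; exists (`|Tn n 0 (fn n) - Phi n (T 0 f)|)%:E => //.
    by exists 0 => //; rewrite /= in_itv /= lexx ltW.
  have se e : 0 < e -> \forall n \near \oo, (s n <= e%:E)%E.
    move=> e0; have := uniform a tmax fn f e a0 cG cf e0; apply: filterS => n Un.
    apply: ge_ereal_sup => _ [t /= tt <-]; rewrite lee_fin Un //.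
  have sfin n e : (s n <= e%:E)%E -> s n \is a fin_num.
    by move=> se'; rewrite ge0_fin_numE // (le_lt_trans se') ?ltry.
  apply/fine_cvgP; split; first by apply: filterS (se 1 ltr01) => n; exact: sfin.
  apply/cvgrPdist_le => e e0; apply: filterS (se e e0) => n sne.
  rewrite sub0r normrN ger0_norm ?fine_ge0 // -lee_fin fineK //.
  exact: sfin sne.
(* The interval [[0, t + 1]] contains [t] and has positive length even when [t = 0]. *)
- move=> cU; apply: cvg_resolvent => t t0 fn f cf.
  have /fine_cvgP[sfin s0] := cU (t + 1) (ltr_wpDl t0 ltr01) fn f cf.
  apply: squeeze_cvgr (@cvg_cst _ (0:R) _ _ _) s0.
  apply: filterS sfin => n sn; rewrite normr_ge0 /= -lee_fin fineK // distrC.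
  apply: ereal_sup_ubound; exists t => //=.
  by rewrite in_itv /= t0 lerDl ler01.
Qed.
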